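(* There is no locally finite, lower bounded lattice $L$ such that $\mathrm{Con_c}\,L\cong S_{\omega_1}$.
   Context: For lattices $K$ and $L$, a lattice homomorphism $f\colon K\to L$ is lower bounded if for every $a\in L$ the set $\{x\in K\mid a\leq f(x)\}$ is either empty or has a least element. A lattice $L$ is lower bounded if every homomorphism from a finitely generated lattice to $L$ is lower bounded. A lattice is locally finite if each of its finitely generated sublattices is finite. $\mathrm{Con_c}\,L$ is the join-semilattice with zero of all compact (i.e. finitely generated) congruences of $L$, under inclusion. The semilattice $S_{\omega_1}$: ordinals are identified with the set of smaller ordinals. Let $\mathcal{B}_{\omega_1}$ be the Boolean subalgebra of the powerset of $\omega_1$ generated by all intervals of $\omega_1$. Put $\mathcal{I}_{\omega_1}=\{x\in\mathcal{B}_{\omega_1}\mid \exists\alpha<\omega_1,\ x\subseteq\alpha\}$, $\mathcal{F}_{\omega_1}=\{x\in\mathcal{B}_{\omega_1}\mid \exists\alpha<\omega_1,\ \omega_1\setminus\alpha\subseteq x\}$, $D_{\omega_1}=\{x\subseteq\omega_1\mid x\text{ is finite or }x=\omega_1\}$, and $D_{\omega_1}^-=D_{\omega_1}\setminus\{\varnothing\}$. Then $S_{\omega_1}=(\{\varnothing\}\times\mathcal{I}_{\omega_1})\cup(D_{\omega_1}^-\times\mathcal{F}_{\omega_1})$, ordered by componentwise inclusion; it is a distributive join-semilattice with $0$ and $1$ (joins are componentwise unions). *)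

(* Defs.v *)
From HB Require Import structures.
From mathcomp Require Import all_boot all_order.
From mathcomp Require Import interval.
From mathcomp Require Import all_classical.
From mathcomp Require wochoice.

Set Implicit Arguments.
Unset Strict Implicit.
Unset Printing Implicit Defensive.

Import Order.TTheory.
Local Open Scope classical_set_scope.
Local Open Scope order_scope.

Definition sublattice d (L : latticeType d) (A : set L) : Prop :=
  (forall x y, A x -> A y -> A (x `&` y)) /\
  (forall x y, A x -> A y -> A (x `|` y)).

Definition finitely_generated_lattice d (K : latticeType d) : Prop :=
  exists A : set K, finite_set A /\ smallest (@sublattice d K) A = setT.

Definition locally_finite d (L : latticeType d) : Prop :=
  forall A : set L, finite_set A -> finite_set (smallest (@sublattice d L) A).

Definition lower_bounded_hom dK (K : latticeType dK) dL (L : latticeType dL)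
    (f : {lmorphism K -> L}) : Prop :=
  forall a : L, [set x | a <= f x] = set0 \/
    exists m, [set x | a <= f x] m /\ forall x, a <= f x -> m <= x.

Definition lower_bounded_lattice dL (L : latticeType dL) : Prop :=
  forall dK (K : latticeType dK), finitely_generated_lattice K ->
  forall f : {lmorphism K -> L}, lower_bounded_hom f.

Definition congruence d (L : latticeType d) (theta : set (L * L)) : Prop :=
  [/\ forall x, theta (x, x),
      forall x y, theta (x, y) -> theta (y, x),
      forall x y z, theta (x, y) -> theta (y, z) -> theta (x, z),
      forall x y x' y', theta (x, y) -> theta (x', y') ->
        theta (x `&` x', y `&` y')
    & forall x y x' y', theta (x, y) -> theta (x', y') ->
        theta (x `|` x', y `|` y')].

Definition compact_congruences d (L : latticeType d) : set (set (L * L)) :=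
  [set theta | exists E : set (L * L),
     finite_set E /\ theta = smallest (@congruence d L) E].
Arguments compact_congruences {d} L.

(* The order is inherited from [set (L * L)], i.e. it is inclusion. *)
Definition Conc d (L : latticeType d) : Type :=
  {theta : set (L * L) | theta \in compact_congruences L}.

HB.instance Definition _ d (L : latticeType d) := SubChoice.on (Conc L).
Fact conc_display : Order.disp_t. Proof. exact: Order.Disp tt tt. Qed.
HB.instance Definition _ d (L : latticeType d) :=
  [SubChoice_isSubPOrder of Conc L by <: with conc_display].

Lemma smallest_congruence d (L : latticeType d) (E : set (L * L)) :
  congruence (smallest (@congruence d L) E).
Proof.
split=> [x|x y h|x y z h k|x y x' y' h k|x y x' y' h k] T [cT ET];
  case: (cT) => r s t m j; first exact: r.
- by apply: s; apply: h.
- by apply: t (h _ _) (k _ _).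
- by apply: m; [apply: h|apply: k].
- by apply: j; [apply: h|apply: k].
Qed.

Lemma compact_congruenceU d (L : latticeType d) (s t : Conc L) :
  smallest (@congruence d L) (val s `|` val t) \in compact_congruences L.
Proof.
case: s t => s /= /set_mem[E [finE ->]] [t /= /set_mem[F [finF ->]]].
apply/mem_set; exists (E `|` F); split; first by rewrite finite_setU.
apply/seteqP; split; apply: smallest_sub.
- exact: smallest_congruence.
- by rewrite subUset; split; apply: smallest_sub;
    try exact: smallest_congruence; apply: sub_smallest => x; [left|right].
- exact: smallest_congruence.
- by apply: sub_smallest => x [Ex|Fx]; [left|right]; apply: sub_gen_smallest.
Qed.

Definition conc_join d (L : latticeType d) (s t : Conc L) : Conc L :=
  Sub (smallest (@congruence d L) (val s `|` val t)) (compact_congruenceU s t).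

Lemma conc_leUx d (L : latticeType d) (s t u : Conc L) :
  (conc_join s t <= u) = (s <= u) && (t <= u).
Proof.
have congu : congruence (val u).
  by have /set_mem[E [_ ->]] := valP u; exact: smallest_congruence.
rewrite -!Order.le_val /=; apply/asboolP/andP => [stu|[/asboolP su /asboolP tu]].
  by split; apply/asboolP => x ?; apply: stu; apply: sub_gen_smallest;
    [left|right].
by apply: smallest_sub => //; rewrite subUset.
Qed.

HB.instance Definition _ d (L : latticeType d) :=
  Order.POrder_isJoinSemilattice.Build conc_display (Conc L) (@conc_leUx d L).

Lemma compact_congruence0 d (L : latticeType d) :
  smallest (@congruence d L) set0 \in compact_congruences L.
Proof. by apply/mem_set; exists set0; split=> //; exact: finite_set0. Qed.

Definition conc_bottom d (L : latticeType d) : Conc L :=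
  Sub (smallest (@congruence d L) set0) (compact_congruence0 L).

Lemma conc_le0x d (L : latticeType d) (s : Conc L) : conc_bottom L <= s.
Proof.
rewrite -Order.le_val /=; apply/asboolP; apply: smallest_sub; last exact: sub0set.
by have /set_mem[E [_ ->]] := valP s; exact: smallest_congruence.
Qed.

HB.instance Definition _ d (L : latticeType d) :=
  Order.hasBottom.Build conc_display (Conc L) (@conc_le0x d L).

(* The ordinal omega_1, realized as the set of points of a well-ordered set of
   uncountable cardinality that have only countably many predecessors. It is
   characterized up to isomorphism by the lemmas [omega1_well_order],
   [omega1_uncountable] and [omega1_countable_seg] below. *)
Definition omega1_rel : rel (set nat) :=
  sval (wochoice.well_ordering_principle (set nat)).

Definition omega1 : Type :=
  {x : set nat | `[< countable [set y | omega1_rel y x && (y != x)] >]}.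

HB.instance Definition _ := SubChoice.on omega1.

Lemma omega1_rel_wo : wochoice.well_order omega1_rel.
Proof. exact: (svalP (wochoice.well_ordering_principle (set nat))). Qed.

Lemma omega1_rel_chain : wochoice.wo_chain omega1_rel predT.
Proof. by move=> A _; exact: omega1_rel_wo. Qed.

Lemma omega1_rel_total : total omega1_rel.
Proof. by move=> x y; exact: (wochoice.wo_chainW omega1_rel_chain). Qed.

Lemma omega1_rel_refl : reflexive omega1_rel.
Proof. by move=> x; exact: (wochoice.wo_chain_reflexive omega1_rel_chain). Qed.

Lemma omega1_rel_anti : antisymmetric omega1_rel.
Proof.
by move=> x y; exact: (wochoice.wo_chain_antisymmetric omega1_rel_chain).
Qed.

Lemma omega1_rel_trans : transitive omega1_rel.
Proof.
move=> y x z xy yz.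
have [] := omega1_rel_wo (A := mem [:: x; y; z]).
  by exists x; rewrite !inE eqxx.
move=> m [[min lbm] _].
have mx : omega1_rel m x by apply: lbm; rewrite !inE eqxx.
have my : omega1_rel m y by apply: lbm; rewrite !inE eqxx orbT.
have mz : omega1_rel m z by apply: lbm; rewrite !inE eqxx !orbT.
move: min; rewrite !inE => /or3P[] /eqP e; subst m => //.
- suff -> : x = y by [].
  by apply: omega1_rel_anti; rewrite xy mx.
- suff -> : z = y by [].
  by apply: omega1_rel_anti; rewrite yz my.
Qed.

Fact omega1_display : Order.disp_t. Proof. exact: Order.Disp tt tt. Qed.

Definition omega1_le : rel omega1 := fun x y => omega1_rel (val x) (val y).

Lemma omega1_le_refl : reflexive omega1_le.
Proof. by move=> x; exact: omega1_rel_refl. Qed.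

Lemma omega1_le_anti : antisymmetric omega1_le.
Proof. by move=> x y /omega1_rel_anti /val_inj. Qed.

Lemma omega1_le_trans : transitive omega1_le.
Proof. by move=> y x z; exact: omega1_rel_trans. Qed.

HB.instance Definition _ := Order.Le_isPOrder.Build omega1_display omega1
  omega1_le_refl omega1_le_anti omega1_le_trans.

Lemma omega1_le_total : total (<=%O : rel omega1).
Proof. by move=> x y; exact: omega1_rel_total. Qed.

HB.instance Definition _ :=
  Order.POrder_isTotal.Build omega1_display omega1 omega1_le_total.

Lemma omega1_well_order : wochoice.well_order (<=%O : rel omega1).
Proof.
apply: wochoice.antisymmetric_well_order => [|A [a Aa]]; first exact: le_anti.
pose B : {pred set nat} := [pred x | `[< exists2 u, u \in A & val u = x >]].
have [|_ [[/asboolP[m Am <-] lbm] _]] := omega1_rel_wo (A := B).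
  by exists (val a); apply/asboolP; exists a.
by exists m; split=> // x Ax; apply: lbm; apply/asboolP; exists x.
Qed.

Lemma omega1_countable_seg (a : omega1) : countable [set b : omega1 | b < a].
Proof.
have /asboolP/countable_injP[f finj] := valP a.
apply/countable_injP; exists (f \o val) => x y /set_mem xa /set_mem ya fxy.
apply/val_inj/finj => //; apply/mem_set.
- by move: xa => /=; rewrite lt_neqAle andbC.
- by move: ya => /=; rewrite lt_neqAle andbC.
Qed.

Lemma omega1_uncountable : ~ countable [set: omega1].
Proof.
move=> cW.
pose P (x : set nat) : Prop := countable [set y | omega1_rel y x && (y != x)].
have cP : countable [set x | P x].
  have /countable_injP[f finj] := cW; apply/countable_injP.
  exists (fun x => if insub x is Some u then f (u : omega1) else 0%N).
  move=> x y /set_mem Px /set_mem Py.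
  rewrite !insubT; try exact/asboolP; move=> Px' Py' fxy.
  by have /(congr1 val) := finj _ _ (mem_set Logic.I) (mem_set Logic.I) fxy.
have [allP|/existsNP[x0 NPx0]] := pselect (forall x, P x).
  have /countable_injP[f finj] := cP.
  pose D : set nat := [set n | exists x, f x = n /\ ~ x n].
  have [DD|nDD] := pselect (D (f D)).
    have [x [fx nx]] := DD; apply: nx.
    by rewrite (finj x D) //; apply/mem_set; exact: allP.
  by apply: (nDD); exists D.
have [|m [[/asboolP Pm lbm] _]] := omega1_rel_wo (A := [pred x | `[< ~ P x >]]).
  by exists x0; apply/asboolP.
apply: Pm; apply: sub_countable cP; apply: subset_card_le => y /= /andP[ym neq].
apply: contrapT => Py; move/negP: neq; apply; apply/eqP/omega1_rel_anti.
by rewrite ym lbm //; apply/asboolP.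
Qed.

(* [b < a] says that [b] is an element of the ordinal [a]. *)
Definition ord_set (a : omega1) : set omega1 := [set b | b < a].

Definition boolean_subalgebra T (B : set (set T)) : Prop :=
  [/\ B set0, (forall x, B x -> B (~` x)%classic) & setU_closed B].

Definition B_omega1 : set (set omega1) :=
  smallest (@boolean_subalgebra omega1)
    [set [set` i] | i in [set: interval omega1]].

Definition I_omega1 : set (set omega1) :=
  [set x | B_omega1 x /\ exists a : omega1, x `<=` ord_set a].

Definition F_omega1 : set (set omega1) :=
  [set x | B_omega1 x /\ exists a : omega1, (~` ord_set a `<=` x)%classic].

Definition D_omega1 : set (set omega1) :=
  [set x | finite_set x \/ x = setT].

Definition S_omega1_set : set (set omega1 *p set omega1) :=
  (([set set0] `*` I_omega1) `|` ((D_omega1 `\ set0) `*` F_omega1))%classic.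

(* The order is inherited from the product order on pairs of sets, i.e. it is
   componentwise inclusion; joins are componentwise unions. *)
Definition S_omega1 : Type :=
  {x : set omega1 *p set omega1 | x \in S_omega1_set}.

HB.instance Definition _ := SubChoice.on S_omega1.
Fact S_omega1_display : Order.disp_t. Proof. exact: Order.Disp tt tt. Qed.
HB.instance Definition _ :=
  [SubChoice_isSubPOrder of S_omega1 by <: with S_omega1_display].

Lemma boolean_subalgebra_B_omega1 : boolean_subalgebra B_omega1.
Proof.
split=> [T [[]]//|x Bx T [cT GT]|x y Bx By T [cT GT]]; case: (cT) => _ cC cU.
- by apply: cC; apply: Bx.
- by apply: cU; [apply: Bx|apply: By].
Qed.

Lemma S_omega1_setU (x y : set omega1 *p set omega1) :
  S_omega1_set x -> S_omega1_set y -> S_omega1_set (x `|` y).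
Proof.
have [_ _ BU] := boolean_subalgebra_B_omega1.
have DU u v : D_omega1 u -> D_omega1 v -> D_omega1 (u `|` v)%classic.
  move=> [fu|->] [fv|->]; rewrite ?setUT ?setTU; try by right.
  by left; rewrite finite_setU.
have FU u v : F_omega1 u -> B_omega1 v -> F_omega1 (u `|` v)%classic.
  by move=> [Bu [a ua]] Bv; split; [exact: BU|exists a => z /ua; left].
case: x y => [x1 x2] [y1 y2]; rewrite /S_omega1_set.
case=> /= [[-> [Bx2 [a xa]]]|[[Dx1 nx1] Fx2]];
  case=> [[-> [By2 [b yb]]]|[[Dy1 ny1] Fy2]].
- left; split=> /=; first by rewrite joinx0.
  split; first exact: BU.
  exists (Order.max a b) => z [/xa|/yb] /=; rewrite /ord_set /= lt_max => ->//.
  by rewrite orbT.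
- right; split=> /=; first by rewrite join0x.
  by rewrite joinC; exact: FU.
- right; split=> /=; first by rewrite joinx0.
  exact: FU.
- right; split=> /=; last by apply: FU; [|case: Fy2].
  split; first exact: DU.
  by rewrite /= setU_eq0 => -[].
Qed.

Lemma S_omega1_setU_in (s t : S_omega1) : val s `|` val t \in S_omega1_set.
Proof.
by apply/mem_set/S_omega1_setU; apply/set_mem; [exact: valP s|exact: valP t].
Qed.

Definition S_omega1_join (s t : S_omega1) : S_omega1 :=
  Sub (val s `|` val t) (S_omega1_setU_in s t).

Lemma S_omega1_leUx (s t u : S_omega1) :
  (S_omega1_join s t <= u) = (s <= u) && (t <= u).
Proof. by rewrite -!Order.le_val /= leUx. Qed.

HB.instance Definition _ := Order.POrder_isJoinSemilattice.Build
  S_omega1_display S_omega1 S_omega1_leUx.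

Lemma S_omega1_set0 : (\bot : set omega1 *p set omega1) \in S_omega1_set.
Proof.
apply/mem_set; left; split=> //=; split.
  by case: boolean_subalgebra_B_omega1.
have [a _] : exists a : omega1, True; last by exists a => x.
apply: contrapT => /forallNP n; apply: omega1_uncountable.
by rewrite (_ : setT = set0) // -subset0 => x _; case: (n x).
Qed.

Definition S_omega1_bottom : S_omega1 := Sub \bot S_omega1_set0.

Lemma S_omega1_le0x (s : S_omega1) : S_omega1_bottom <= s.
Proof. by rewrite -Order.le_val /= le0x. Qed.

HB.instance Definition _ := Order.hasBottom.Build
  S_omega1_display S_omega1 S_omega1_le0x.

Definition join0_isomorphic dS (S : bJoinSemilatticeType dS)
    dT (T : bJoinSemilatticeType dT) : Prop :=
  exists f : S -> T,
    [/\ bijective f, {morph f : x y / x `|` y} & f \bot = \bot].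

(* Main.v *)
(** The lattice [L] is forced to be distributive.  Write an element of
    [S_omega1] as a pair [(d, x)].  For each point [p], the congruence [psi_p]
    corresponding to [(omega1, omega1 \ {p})] is maximal, so [L / psi_p] is
    simple.  In a finite sublattice of a lower bounded lattice there is no
    infinite chain for the join-dependency relation (such a chain would allow
    to delay arbitrarily the appearance of some element in a finitely generated
    lattice of filtered ideals mapping to [L]); hence a simple, locally finite,
    lower bounded lattice has at most two elements.  So every [L / psi_p] is
    a chain of at most two elements, and the second component of the congruence
    generated by [(x, y)] is the set of [p] with [(x, y) \notin psi_p].

    Now choose [x <= y] and [z <= w] generating congruences [({p}, X)] and
    [({r}, Z)] with [p <> r].  The pair [x \/ (y /\ z)], [x \/ (y /\ w)]
    generates a congruence contained in both, so its first component is empty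
    and its second component must be bounded; but by distributivity it contains
    the cobounded set [X /\ Z]. *)
From HB Require Import structures.
Require Import Defs.
From mathcomp Require Import all_boot all_order.
From mathcomp Require Import interval.
From mathcomp Require Import all_classical.

Set Implicit Arguments.
Unset Strict Implicit.
Unset Printing Implicit Defensive.

Import Order.TTheory.
Local Open Scope classical_set_scope.
Local Open Scope order_scope.

(** * Sublattices as lattices *)

Definition sublat d (L : latticeType d) (F : set L) (HF : sublattice F)
    : Type :=
  {x : L | x \in F}.

Section Sublat.
Variables (d : Order.disp_t) (L : latticeType d) (F : set L).
Hypothesis HF : sublattice F.

Lemma sublat_meet_closed : {in mem F &, forall x y, x `&` y \in mem F}.
Proof. by move=> x y /set_mem Fx /set_mem Fy; apply/mem_set/HF.1. Qed.

Lemma sublat_join_closed : {in mem F &, forall x y, x `|` y \in mem F}.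
Proof. by move=> x y /set_mem Fx /set_mem Fy; apply/mem_set/HF.2. Qed.

HB.instance Definition _ := SubChoice.on (sublat HF).
HB.instance Definition _ :=
  Order.SubChoice_isSubLattice.Build d L (mem F) d (sublat HF)
    sublat_meet_closed sublat_join_closed.

Lemma finite_sublat : finite_set F -> finite_set [set: sublat HF].
Proof.
move=> finF; have -> : [set: sublat HF] = val @^-1` F.
  by apply/seteqP; split=> // -[x /= /set_mem].
by apply: finite_preimage => // x y _ _; exact: val_inj.
Qed.

Lemma val_sublatI (x y : sublat HF) : val (x `&` y) = val x `&` val y.
Proof. by []. Qed.

Lemma val_sublatU (x y : sublat HF) : val (x `|` y) = val x `|` val y.
Proof. by []. Qed.

End Sublat.

Lemma smallest_sublattice d (L : latticeType d) (A : set L) :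
  sublattice (smallest (@sublattice d L) A).
Proof.
by split=> x y Ax Ay T hT; [apply: hT.1.1|apply: hT.1.2];
  first [exact: Ax|exact: Ay].
Qed.

(** * Filtered ideals *)

Section Filtration.
Variables (d : Order.disp_t) (M : latticeType d).
Implicit Types A : set (nat * M).

(* [A (k, x)] reads: [x] is reached by level [k]; a join costs one level. *)
Definition filtration A : Prop :=
  (forall k j x y, A (k, x) -> (k <= j)%N -> y <= x -> A (j, y)) /\
  (forall k x y, A (k, x) -> A (k, y) -> A (k.+1, x `|` y)).

Lemma smallest_filtration A : filtration (smallest filtration A).
Proof.
split=> [k j x y Akx kj yx T [fT AT]|k x y Akx Aky T [fT AT]].
- by apply: fT.1 (Akx _ _) kj yx.
- by apply: fT.2; [apply: Akx|apply: Aky].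
Qed.

(** An increasing sequence of down-sets exhausting the principal ideal of [u.1]. Storing [u.1]
    beside the sequence makes evaluation in [M] a projection. *)
Definition filtered_ideal_set : set (M *p set (nat * M)) :=
  [set u | filtration u.2 /\ forall x, x <= u.1 <-> exists k, u.2 (k, x)].

Definition filtered_ideal : Type :=
  {u : M *p set (nat * M) | u \in filtered_ideal_set}.

HB.instance Definition _ := SubChoice.on filtered_ideal.
HB.instance Definition _ :=
  [SubChoice_isSubPOrder of filtered_ideal by <: with d].

Lemma filtered_idealI (u v : M *p set (nat * M)) :
  filtered_ideal_set u -> filtered_ideal_set v ->
  filtered_ideal_set (u `&` v).
Proof.
case: u v => [a A] [b B] [/= fA aA] [/= fB bB]; split=> /=.
  split=> [k j x y [Akx Bkx] kj yx|k x y [Akx Bkx] [Aky Bky]].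
  - by split; [apply: fA.1 Akx kj yx|apply: fB.1 Bkx kj yx].
  - by split; [apply: fA.2|apply: fB.2].
move=> x; rewrite lexI; split=> [/andP[/aA[k Ak] /bB[j Bj]]|[k [Ak Bk]]].
- exists (maxn k j); split.
  + by apply: fA.1 Ak _ _; rewrite ?leq_maxl.
  + by apply: fB.1 Bj _ _; rewrite ?leq_maxr.
- by apply/andP; split; [apply/aA|apply/bB]; exists k.
Qed.

Lemma filtered_idealU (u v : M *p set (nat * M)) :
  filtered_ideal_set u -> filtered_ideal_set v ->
  filtered_ideal_set (u.1 `|` v.1, smallest filtration (u.2 `|` v.2)).
Proof.
case: u v => [a A] [b B] [/= fA aA] [/= fB bB].
have fC := smallest_filtration (A `|` B).
have AC : (A `|` B `<=` smallest filtration (A `|` B))%classic by [].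
split=> //= x; split=> [xab|[k]].
- have /aA[k Ak] := lexx a; have /bB[j Bj] := lexx b.
  exists (maxn k j).+1; apply: (fC.1) (leqnn _) xab; apply: fC.2.
  + by apply: fC.1 (AC _ (or_introl Ak)) _ _; rewrite ?leq_maxl.
  + by apply: fC.1 (AC _ (or_intror Bj)) _ _; rewrite ?leq_maxr.
(* The filtration whose every level is the principal ideal of the join contains both [A] and [B]. *)
- move=> /(_ [set u | u.2 <= a `|` b]); apply; split.
    split=> /= [_ _ z y za _ yz|_ z y za ya]; first exact: le_trans yz za.
    by rewrite leUx za.
  case=> i y /= [Ay|By].
  + by rewrite lexUl //; apply/aA; exists i.
  + by rewrite lexUr //; apply/bB; exists i.
Qed.

Lemma filtered_idealI_in (u v : filtered_ideal) :
  val u `&` val v \in filtered_ideal_set.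
Proof.
by apply/mem_set/filtered_idealI; apply/set_mem; [exact: valP u|exact: valP v].
Qed.

Lemma filtered_idealU_in (u v : filtered_ideal) :
  (((val u).1 `|` (val v).1, smallest filtration ((val u).2 `|` (val v).2))
    : M *p set (nat * M)) \in filtered_ideal_set.
Proof.
by apply/mem_set/filtered_idealU; apply/set_mem; [exact: valP u|exact: valP v].
Qed.

Definition filtered_ideal_meet (u v : filtered_ideal) : filtered_ideal :=
  Sub (val u `&` val v) (filtered_idealI_in u v).

Definition filtered_ideal_join (u v : filtered_ideal) : filtered_ideal :=
  exist _ (_ : M *p set (nat * M)) (filtered_idealU_in u v).

Lemma filtered_ideal_lexI (u v w : filtered_ideal) :
  (u <= filtered_ideal_meet v w) = (u <= v) && (u <= w).
Proof. by rewrite -!Order.le_val /= lexI. Qed.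

Lemma filtered_ideal_leUx (u v w : filtered_ideal) :
  (filtered_ideal_join u v <= w) = (u <= w) && (v <= w).
Proof.
have /set_mem[fw _] := valP w.
rewrite -!Order.le_val /= !leEprod /= leUx andbACA; congr andb.
apply/asboolP/andP => [uvw|[/asboolP uw /asboolP vw]].
  by split; apply/asboolP => x ?; apply: uvw; apply: sub_gen_smallest;
    [left|right].
by apply: smallest_sub => //; rewrite subUset.
Qed.

HB.instance Definition _ := Order.POrder_isMeetSemilattice.Build d
  filtered_ideal filtered_ideal_lexI.
HB.instance Definition _ := Order.POrder_isJoinSemilattice.Build d
  filtered_ideal filtered_ideal_leUx.

Lemma filtered_ideal_topI (u v : filtered_ideal) :
  (val (u `&` v)).1 = (val u).1 `&` (val v).1.
Proof. exact: (erefl (val (filtered_ideal_meet u v)).1). Qed.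

Lemma filtered_ideal_topU (u v : filtered_ideal) :
  (val (u `|` v)).1 = (val u).1 `|` (val v).1.
Proof. exact: (erefl (val (filtered_ideal_join u v)).1). Qed.

Lemma filtered_ideal_le2 (u v : filtered_ideal) :
  u <= v -> ((val u).2 `<=` (val v).2)%classic.
Proof. by rewrite -Order.le_val => /andP[_ /asboolP]. Qed.

Lemma filtered_ideal_gen_subproof (x : M) :
  ((x, [set u | u.2 <= x]) : M *p set (nat * M)) \in filtered_ideal_set.
Proof.
apply/mem_set; split=> /=; last by move=> y; split=> [|[]//]; exists 0%N.
split=> /= [_ _ z y za _ yz|_ z y za ya]; first exact: le_trans yz za.
by rewrite leUx za.
Qed.

(** No delay: the whole principal ideal is present at level 0. *)
Definition filtered_ideal_gen (x : M) : filtered_ideal :=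
  exist _ (_ : M *p set (nat * M)) (filtered_ideal_gen_subproof x).

End Filtration.

Lemma sublat_finitely_generated d (K : latticeType d) (A : set K) :
  finite_set A ->
  finitely_generated_lattice (sublat (smallest_sublattice A)).
Proof.
move=> finA; set K' := sublat _; exists (val @^-1` A : set K'); split.
  by apply: finite_preimage => // x y _ _; exact: val_inj.
apply/seteqP; split=> // x _ T [HT AT].
have /set_mem/(_ [set y | exists2 z, T z & val z = y])[] := valP x.
- split.
  + split=> _ _ [y Ty <-] [z Tz <-].
    * by exists (y `&` z); [exact: HT.1|].
    * by exists (y `|` z); [exact: HT.2|].
  + move=> y Ay; have Gy := sub_gen_smallest (C := @sublattice d _) Ay.
    by exists (Sub y (mem_set Gy) : K'); [apply: AT|].
- by move=> y Ty /val_inj <-.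
Qed.

(* The usual join-dependency relation [q D q'] when [q] and [q'] are
   join-irreducible: then [s <= t] for the lower cover [s] of [q']. *)
Definition join_dep d (M : latticeType d) (q q' : M) : Prop :=
  q <> q' /\
  exists t, [/\ ~ q <= t, q <= t `|` q' & forall s, s < q' -> s <= t].

(** * Delaying the appearance of an element *)

Section Delay.
Variables (d : Order.disp_t) (M : latticeType d).
Local Notation gens := (range (@filtered_ideal_gen d M)).
Local Notation K := (smallest (@sublattice _ (filtered_ideal M)) gens).

(** All members of [u] lie below its top [q], so the strict inequality says exactly that [q] is
    absent before level [k]. *)
Definition delayed k (q : M) : Prop :=
  exists u : filtered_ideal M, [/\ K u, (val u).1 = q &
    forall j x, (j < k)%N -> (val u).2 (j, x) -> x < q].

(** Since [q] is not below [t], it arises only by joining [t] with [q'], which [u] withholds until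
    level [k]; that join costs the extra level. *)
Lemma delayed_step k q q' : join_dep q q' -> delayed k q' -> delayed k.+1 q.
Proof.
move=> [neq [t [qt qtq' tmin]]] [u [Ku uq' delay]].
have Kgen x : K (filtered_ideal_gen x) by apply: sub_gen_smallest; exists x.
have [KI KU] := smallest_sublattice gens.
exists (filtered_ideal_gen q `&` (u `|` filtered_ideal_gen t)); split.
- by apply: KI => //; apply: KU.
- by rewrite /= uq'; apply/meet_idPl; rewrite joinC.
move=> j x jk [/= xq uj]; rewrite lt_neqAle xq andbT; apply/eqP => xeq.
rewrite {}xeq in uj; clear x xq.
(* A filtration bounding the join: before level [k] everything is below [t], at level [k] below [t]
   or below [q'], later anything is allowed. *)
pose U : set (nat * M) := [set v |
  ((v.1 < k)%N -> v.2 <= t) /\ (v.1 = k -> v.2 <= t \/ v.2 <= q')].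
have qU : U (j, q).
  apply: uj; split.
    split=> [i l x y /= [Ux1 Ux2] il yx|i x y [/= Ux1 Ux2] [/= Uy1 Uy2]].
    - split=> /= [lk|lk].
        by apply: le_trans yx _; apply: Ux1; exact: leq_ltn_trans il lk.
      move: il; rewrite lk leq_eqVlt => /predU1P[/Ux2[]|/Ux1] xt;
      by [left; exact: le_trans xt|right; exact: le_trans xt].
    - split=> /= ik.
      + by rewrite leUx Ux1 ?Uy1 // ltnW.
      + by left; rewrite leUx Ux1 ?Uy1 // -ik.
  move=> [i x] [/= ux|/= xt]; last by split=> //=; left.
  split=> /= ik; first exact/tmin/(delay i).
  right; have /set_mem[_ idl] := valP u.
  by rewrite -uq'; apply/idl; exists i.
move: jk; rewrite ltnS leq_eqVlt => /predU1P[jk|jk].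
- have [//|/= qq'] := qU.2 jk.
  by apply/qt/tmin; rewrite lt_neqAle qq' andbT; apply/eqP.
- exact/qt/qU.1.
Qed.

(** Non-accessibility passes on to some [q'] with [join_dep q q'], so [delayed_step] can be iterated
    [k] times. *)
Lemma delayed_not_Acc k q : ~ Acc (fun q' q => join_dep q q') q -> delayed k q.
Proof.
elim: k q => [|k IH] q nacc.
  exists (filtered_ideal_gen q); split=> //.
  by apply: sub_gen_smallest; exists q.
have [q' [qq' nacc']] : exists q', join_dep q q' /\
    ~ Acc (fun q' q => join_dep q q') q'.
  apply: contrapT => /forallNP H; apply: nacc; constructor=> q' qq'.
  by apply: contrapT => nacc'; apply: (H q').
exact: delayed_step qq' (IH _ nacc').
Qed.

End Delay.

(** * Termination of join dependency *)

Section LowerBounded.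
Variables (d : Order.disp_t) (L : latticeType d) (F : set L).
Hypothesis HF : sublattice F.
Local Notation M := (sublat HF).
Local Notation gens := (range (@filtered_ideal_gen d M)).

Definition eval_filtered (u : sublat (smallest_sublattice gens)) : L :=
  val (val (val u)).1.

Lemma eval_filteredI : {morph eval_filtered : u v / u `&` v}.
Proof.
by move=> u v; rewrite /eval_filtered (val_sublatI u) filtered_ideal_topI.
Qed.

Lemma eval_filteredU : {morph eval_filtered : u v / u `|` v}.
Proof.
by move=> u v; rewrite /eval_filtered (val_sublatU u) filtered_ideal_topU.
Qed.

Lemma eval_filtered_homo : {homo eval_filtered : u v / u <= v}.
Proof.
by move=> u v uv; apply/meet_idPl; rewrite -eval_filteredI (meet_idPl _).
Qed.

HB.instance Definition _ := Order.isOrderMorphism.Build _ _ _ _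
  eval_filtered eval_filtered_homo.
HB.instance Definition _ := Order.isLatticeMorphism.Build _ _ _ _
  eval_filtered eval_filteredI eval_filteredU.

(** A least [m] with value above [q] contains [q] at some level [k], yet lies below every preimage
    of [q], even one delayed past level [k]. *)
Lemma join_dep_Acc (q : M) : finite_set F -> lower_bounded_lattice L ->
  Acc (fun q' q => join_dep q q') q.
Proof.
move=> finF lbL; apply: contrapT => nacc.
have fing : finite_set gens.
  by apply: finite_image; exact: finite_sublat.
have := lbL _ _ (sublat_finitely_generated fing) eval_filtered (val q).
have get k : exists u : sublat (smallest_sublattice gens),
    [/\ eval_filtered u = val q &
    forall j x, (j < k)%N -> (val (val u)).2 (j, x) -> x < q].
  have [u [Ku uq ult]] := delayed_not_Acc k nacc.
  by exists (Sub u (mem_set Ku)); split=> //=; rewrite /eval_filtered /= uq.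
case=> [/seteqP[+ _]|[m [/= qm mmin]]].
  by have [u [uq _]] := get 0%N; move=> /(_ u); apply=> /=; rewrite uq.
have /set_mem[_ idl] := valP (val m).
have /idl[k mk] : q <= (val (val m)).1 by [].
have [u [uq ult]] := get k.+1.
have /mmin : val q <= eval_filtered u by rewrite uq.
rewrite -Order.le_val => /filtered_ideal_le2 mu.
by have := ult _ _ (ltnSn k) (mu _ mk); rewrite ltxx.
Qed.

End LowerBounded.

(** * Join dependency and congruences in finite lattices *)

Lemma ex_minimal d (P : porderType d) (A : set P) :
  finite_set [set: P] -> A !=set0 ->
  exists x, A x /\ forall y, y < x -> ~ A y.
Proof.
move=> /finite_seqP[s sP] [x Ax].
have [n] := ubnP (count (fun y => y < x) s); elim: n x Ax => // n IH x Ax xn.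
have [[y [yx Ay]]|/forallNP H] := pselect (exists y, y < x /\ A y); last first.
  by exists x; split=> // y yx Ay; apply: (H y).
(* The count drops because [y] is below [x] but not strictly below itself. *)
apply: (IH y Ay); move: xn; rewrite ltnS; apply: leq_trans.
have ys : y \in s by have : [set: P] y by []; rewrite sP.
apply: (@leq_trans (count (predU (fun z => z < y) (pred1 y)) s)); last first.
  by apply: sub_count => z /orP[/lt_trans/(_ yx)|/eqP ->].
have := count_predUI (fun z => z < y) (pred1 y) s.
rewrite (@eq_count _ (predI _ _) pred0) ?count_pred0 ?addn0 => [->|z /=].
  by rewrite -addn1 leq_add2l -has_count has_pred1.
by case: eqP => [->|]; rewrite ?ltxx ?andbF.
Qed.

Lemma ex_maximal d (P : porderType d) (A : set P) :
  finite_set [set: P] -> A !=set0 ->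
  exists x, A x /\ forall y, x < y -> ~ A y.
Proof. exact: (@ex_minimal _ P^d). Qed.

Section FiniteLattice.
Variables (d : Order.disp_t) (M : latticeType d).
Hypothesis finM : finite_set [set: M].

Inductive join_dep_star (p : M) : M -> Prop :=
| join_dep_refl : join_dep_star p p
| join_dep_step q r :
    join_dep p q -> join_dep_star q r -> join_dep_star p r.

Lemma join_dep_star_rcons p q r :
  join_dep_star p q -> join_dep q r -> join_dep_star p r.
Proof.
elim=> [p' pr|p' q' r' pq _ IH rr].
- exact: join_dep_step pr (join_dep_refl _).
- exact: join_dep_step pq (IH rr).
Qed.

(** Kernel of the map sending [x] to the set of elements reachable from [p] that lie below [x]. *)
Definition join_dep_kernel (p : M) : set (M * M) :=
  [set u | forall q, join_dep_star p q -> (q <= u.1) = (q <= u.2)].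

(** If [q] is below the join of [x] and [z] but not that of [y] and [z], choose [t] maximal above
    the latter and not above [q], then [q'] minimal below [x] and not below [t]. Either [q = q'] or
    [join_dep q q'], so [q'] is reachable and tells [x] from [y]. *)
Lemma join_dep_kernelU (p x y z : M) :
  join_dep_kernel p (x, y) -> join_dep_kernel p (x `|` z, y `|` z).
Proof.
have half x' y' q : join_dep_kernel p (x', y') -> join_dep_star p q ->
    q <= x' `|` z -> q <= y' `|` z.
  move=> xy pq qxz; apply: contrapT => qyz.
  have [//||t [[yzt qt] tmax]] :=
    @ex_maximal _ M [set t | y' `|` z <= t /\ ~ q <= t].
    by exists (y' `|` z).
  have [yt zt] : y' <= t /\ z <= t by apply/andP; rewrite -leUx.
  have [//||q' [[q'x q't] q'min]] :=
    @ex_minimal _ M [set s | s <= x' /\ ~ s <= t].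
    exists x'; split=> // xt; apply: qt; apply: le_trans qxz _.
    by rewrite leUx xt.
  have q'lt s : s < q' -> s <= t.
    move=> sq'; apply: contrapT => st; apply: (q'min s) => //; split=> //.
    exact: le_trans (ltW sq') q'x.
  have : join_dep_star p q'.
    have [<- //|neq] := pselect (q = q').
    apply: join_dep_star_rcons pq _; split=> //; exists t; split=> //.
    apply: contrapT => qtq'; apply: (tmax (t `|` q')).
      by rewrite lt_neqAle leUl andbT; apply/eqP => e; rewrite e leUr in q't.
    by split=> //; exact: lexUl.
  by move=> /xy /= q'xy; apply: q't; apply: le_trans yt; rewrite -q'xy.
move=> xy q pq; apply/idP/idP; apply: half => //.
by move=> r pr; rewrite (xy r pr).
Qed.

Lemma congruence_join_dep_kernel p : congruence (join_dep_kernel p).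
Proof.
have tr x y z : join_dep_kernel p (x, y) -> join_dep_kernel p (y, z) ->
    join_dep_kernel p (x, z).
  by move=> xy yz q pq; rewrite /= (xy _ pq); exact: yz.
split=> //.
- by move=> x y xy q pq; rewrite (xy _ pq).
- move=> x y x' y' xy xy' q pq; rewrite /= !lexI.
  by have /= -> := xy q pq; have /= -> := xy' q pq.
- move=> x y x' y' xy xy'; apply: tr (join_dep_kernelU x' xy) _.
  by rewrite ![y `|` _]joinC; apply: join_dep_kernelU.
Qed.

(* For join-irreducible [p] with lower cover [p0] and a congruence [phi], this
   says that [phi] does not collapse [p] and [p0]. *)
Definition separated (phi : set (M * M)) (p : M) : Prop :=
  forall x y, phi (x, y) -> p <= x -> p <= y.

(** Collapsing [q] to something strictly smaller, hence below [t], would identify the join of [t]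
    and [q] with [t]; only the former is above [p]. *)
Lemma separated_join_dep phi p q :
  congruence phi -> separated phi p -> join_dep p q -> separated phi q.
Proof.
move=> [rf sm tr mt jn] sp [neq [t [pt ptq tmin]]] x y xy qx.
apply: contrapT => qy; apply: pt.
have qyt : q `&` y <= t.
  apply: tmin; rewrite lt_neqAle leIl andbT; apply/eqP => e.
  by apply: qy; rewrite -e leIr.
have : phi (t `|` q, t).
  have /(jn _ _ _ _ (rf t)) := mt _ _ _ _ (rf q) xy.
  by rewrite (meet_idPl qx) (join_idPl qyt).
by move=> /sp; apply.
Qed.

Lemma separated_join_dep_star phi p q :
  congruence phi -> separated phi p -> join_dep_star p q -> separated phi q.
Proof.
move=> cphi + pq; elim: pq => // p' q' r' pq _ IH sp.
exact/IH/(separated_join_dep cphi sp pq).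
Qed.

Lemma sub_join_dep_kernel phi p :
  congruence phi -> separated phi p -> (phi `<=` join_dep_kernel p)%classic.
Proof.
move=> cphi sp [x y] xy q pq; have sq := separated_join_dep_star cphi sp pq.
have [_ sm _ _ _] := cphi.
by apply/idP/idP; apply: sq => //; exact: sm.
Qed.

(** A minimal [p] not collapsed with its meet with [u] works: were [p] collapsed to a smaller
    element, minimality would collapse that element, hence [p], into [u]. *)
Lemma ex_separated phi u w :
  congruence phi -> ~ phi (w `&` u, w) ->
  exists p, [/\ separated phi p, p <= w & ~ p <= u].
Proof.
move=> [rf sm tr mt jn] uw.
have [//||p [[pw pu] pmin]] :=
  @ex_minimal _ M [set p | p <= w /\ ~ phi (p `&` u, p)]; first by exists w.
exists p; split=> // [x y xy px|pu']; last first.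
  by apply: pu; rewrite (meet_idPl pu').
apply: contrapT => py; apply: pu.
have yp : phi (p `&` y, p).
  have := mt _ _ _ _ (rf p) (sm _ _ xy).
  by rewrite (meet_idPl px).
have ypu : phi (p `&` y `&` u, p `&` y).
  apply: contrapT => n; apply: (pmin (p `&` y)).
    rewrite lt_neqAle leIl andbT; apply/eqP => e.
    by apply: py; rewrite -e leIr.
  by split=> //; apply: le_trans pw; exact: leIl.
have := mt _ _ _ _ yp (rf u) => /sm h.
exact: tr h (tr _ _ _ ypu yp).
Qed.

(* In the quotient by [phi], a three-element chain whose two steps generate the
   same congruence would yield an infinite chain for [join_dep]. *)
Lemma no_mutual_generation phi (u w v : M) :
  (forall q : M, Acc (fun q' q => join_dep q q') q) ->
  congruence phi -> u <= w -> w <= v -> ~ phi (u, w) ->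
  (forall theta : set (M * M), congruence theta -> (phi `<=` theta)%classic ->
     theta (w, v) -> theta (u, w)) ->
  (forall theta : set (M * M), congruence theta -> (phi `<=` theta)%classic ->
     theta (u, w) -> theta (w, v)) -> False.
Proof.
move=> wf cphi uw wv nuw wv_uw uw_wv.
(* By induction along [join_dep], only the case [q = p] is new. *)
have none p : forall q, join_dep_star p q -> separated phi q ->
    q <= v -> q <= u.
  elim: (wf p) => {}p _ IH q.
  case=> [sp pv|q' r pq' q'r]; last exact: IH pq' _ q'r.
  have cp := congruence_join_dep_kernel p.
  have sub := sub_join_dep_kernel cphi sp.
  have small r : join_dep_star p r -> r <> p -> r <= v -> r <= u.
    move=> pr; have sr := separated_join_dep_star cphi sp pr.
    by case: r / pr sr => // q1 r1 pq1 qr1 sr _; exact: IH pq1 _ qr1 sr.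
  (* If [p <= w], the kernel of [p] identifies [w] with [v], hence [u] with [w], so [p <= u].
     Otherwise it identifies [u] with [w], hence [w] with [v], so [p <= w]. *)
  have [pw|npw] := pselect (p <= w).
  - apply: contrapT => npu.
    suff /(wv_uw _ cp sub) /(_ p (join_dep_refl _)) /= :
        join_dep_kernel p (w, v).
      by rewrite pw => h; apply: npu; rewrite h.
    move=> r pr /=; apply/idP/idP => [rw|rv]; first exact: le_trans wv.
    have [-> //|rp] := pselect (r = p).
    exact: le_trans (small _ pr rp rv) uw.
  - exfalso; apply: (npw).
    suff /(uw_wv _ cp sub) /(_ p (join_dep_refl _)) /= :
        join_dep_kernel p (u, w) by rewrite pv.
    move=> r pr /=; apply/idP/idP => [ru|rw]; first exact: le_trans uw.
    have [rp|rp] := pselect (r = p); first by case: npw; rewrite -rp.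
    exact: small pr rp (le_trans rw wv).
have [|p [sp pw pu]] := @ex_separated phi u w cphi.
  by rewrite (meet_idPr uw).
exact/pu/(none p p (join_dep_refl _))/(le_trans pw).
Qed.

End FiniteLattice.

(** * Maximal congruences *)

(* Compactness: a pair of the congruence generated by [E] already belongs to
   the congruence generated by [E] in all large enough sublattices. *)
Lemma smallest_congruence_local d (L : latticeType d) (E : set (L * L)) x y :
  smallest (@congruence d L) E (x, y) ->
  exists2 X : set L, finite_set X &
    forall (F : set L) (HF : sublattice F), (X `<=` F)%classic ->
    forall theta : set (sublat HF * sublat HF), congruence theta ->
      (forall a b, E (val a, val b) -> theta (a, b)) ->
    forall a b, val a = x -> val b = y -> theta (a, b).
Proof.
pose R : set (L * L) := [set u | exists2 X : set L, finite_set X &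
    forall (F : set L) (HF : sublattice F), (X `<=` F)%classic ->
    forall theta : set (sublat HF * sublat HF), congruence theta ->
      (forall a b, E (val a, val b) -> theta (a, b)) ->
    forall a b, val a = u.1 -> val b = u.2 -> theta (a, b)].
suff cR : congruence R.
  move=> /(_ R); apply; split=> // -[a b] Eab.
  exists set0; first exact: finite_set0.
  by move=> F HF _ theta _ Et a' b' aE bE; apply: Et; rewrite aE bE.
split.
- move=> a; exists set0; first exact: finite_set0.
  move=> F HF _ theta [rf _ _ _ _] _ a' b' aE bE.
  have -> : a' = b' by apply: val_inj; rewrite aE bE.
  exact: rf.
- move=> a b [X finX H]; exists X => // F HF XF theta ct Et a' b' aE bE.
  by case: (ct) => _ sm _ _ _; apply: sm; apply: H.
(* The middle element [b] is added so that transitivity can be applied inside [F]. *)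
- move=> a b c [X finX HX] [Y finY HY]; exists (X `|` Y `|` [set b])%classic.
    by rewrite !finite_setU.
  move=> F HF XYF theta ct Et a' c' aE cE.
  have Fb : b \in F by apply/mem_set/XYF; right.
  case: (ct) => _ _ tr _ _; apply: (tr _ (Sub b Fb : sublat HF)).
  + by apply: HX => // z Xz; apply: XYF; left; left.
  + by apply: HY => // z Yz; apply: XYF; left; right.
- move=> a b a' b' [X finX HX] [Y finY HY].
  exists (X `|` Y `|` [set a] `|` [set b] `|` [set a'] `|` [set b'])%classic.
    by rewrite !finite_setU.
  move=> F HF XYF theta ct Et u v uE vE.
  have [Fa Fb Fa' Fb'] : [/\ a \in F, b \in F, a' \in F & b' \in F].
    by split; apply/mem_set/XYF; rewrite /=; tauto.
  case: (ct) => _ _ _ mt _.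
  have -> : u = (Sub a Fa : sublat HF) `&` Sub a' Fa' by exact: val_inj.
  have -> : v = (Sub b Fb : sublat HF) `&` Sub b' Fb' by exact: val_inj.
  apply: mt.
  + by apply: HX => // z Xz; apply: XYF; rewrite /=; tauto.
  + by apply: HY => // z Xz; apply: XYF; rewrite /=; tauto.
- move=> a b a' b' [X finX HX] [Y finY HY].
  exists (X `|` Y `|` [set a] `|` [set b] `|` [set a'] `|` [set b'])%classic.
    by rewrite !finite_setU.
  move=> F HF XYF theta ct Et u v uE vE.
  have [Fa Fb Fa' Fb'] : [/\ a \in F, b \in F, a' \in F & b' \in F].
    by split; apply/mem_set/XYF; rewrite /=; tauto.
  case: (ct) => _ _ _ _ jn.
  have -> : u = (Sub a Fa : sublat HF) `|` Sub a' Fa' by exact: val_inj.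
  have -> : v = (Sub b Fb : sublat HF) `|` Sub b' Fb' by exact: val_inj.
  apply: jn.
  + by apply: HX => // z Xz; apply: XYF; rewrite /=; tauto.
  + by apply: HY => // z Xz; apply: XYF; rewrite /=; tauto.
Qed.

(* The quotient by a maximal congruence is simple; this says that it has at
   most two elements. *)
Lemma maximal_congruence_chain d (L : latticeType d) (psi : set (L * L))
    (u w v : L) :
  locally_finite L -> lower_bounded_lattice L -> congruence psi ->
  (forall a b, ~ psi (a, b) ->
    smallest (@congruence d L) (psi `|` [set (a, b)])%classic = setT) ->
  u <= w -> w <= v -> psi (u, w) \/ psi (w, v).
Proof.
move=> lfL lbL cpsi maxpsi uw wv; apply: contrapT => /not_orP[nuw nwv].
have in1 : smallest (@congruence d L) (psi `|` [set (w, v)])%classic (u, w).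
  by rewrite maxpsi.
have in2 : smallest (@congruence d L) (psi `|` [set (u, w)])%classic (w, v).
  by rewrite maxpsi.
have [X finX HX] := smallest_congruence_local in1.
have [Y finY HY] := smallest_congruence_local in2.
(* A finite set supporting both generations; by local finiteness the sublattice it generates is
   finite. *)
pose Z := (X `|` Y `|` [set u] `|` [set w] `|` [set v])%classic.
have [F [HF finF ZF]] : exists F : set L,
    [/\ sublattice F, finite_set F & (Z `<=` F)%classic].
  exists (smallest (@sublattice d L) Z); split.
  - exact: smallest_sublattice.
  - by apply: lfL; rewrite !finite_setU.
  - exact: sub_gen_smallest.
have [Fu Fw Fv] : [/\ u \in F, w \in F & v \in F].
  split; apply/mem_set/ZF; rewrite /Z /=; tauto.
have finM := finite_sublat HF finF.
pose phi : set (sublat HF * sublat HF) := [set c | psi (val c.1, val c.2)].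
have cphi : congruence phi.
  case: cpsi => rf sm tr mt jn; split; rewrite /phi /=.
  - by move=> x; exact: rf.
  - by move=> x y; exact: sm.
  - by move=> x y z; exact: tr.
  - by move=> x y x' y'; exact: mt.
  - by move=> x y x' y'; exact: jn.
pose u' : sublat HF := Sub u Fu; pose w' : sublat HF := Sub w Fw.
pose v' : sublat HF := Sub v Fv.
have uw' : u' <= w' by rewrite -Order.le_val.
have wv' : w' <= v' by rewrite -Order.le_val.
have wf (q : sublat HF) : Acc (fun q' q => join_dep q q') q.
  exact: join_dep_Acc.
apply: (no_mutual_generation finM wf cphi uw' wv' nuw).
- move=> theta ct pt wvt; apply: HX => //.
    by move=> z Xz; apply: ZF; rewrite /Z /=; tauto.
  move=> a b [ab|[aE bE]]; first exact: pt.
  have -> : a = w' by apply: val_inj; exact: aE.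
  by have -> : b = v' by apply: val_inj; exact: bE.
- move=> theta ct pt wvt; apply: HY => //.
    by move=> z Xz; apply: ZF; rewrite /Z /=; tauto.
  move=> a b [ab|[aE bE]]; first exact: pt.
  have -> : a = u' by apply: val_inj; exact: aE.
  by have -> : b = w' by apply: val_inj; exact: bE.
Qed.

(** * Representations of [S_omega1] *)

(** Otherwise [omega1] would be a countable segment plus one point. *)
Lemma omega1_no_max (p : omega1) : exists a, p < a.
Proof.
apply: contrapT => /forallNP H; apply: omega1_uncountable.
pose A b := if b then ord_set p else [set p].
have -> : [set: omega1] = \bigcup_(b in [set: bool]) A b.
  apply/seteqP; split=> // q _; have := H q.
  by case: (ltgtP q p) => // [qp _|-> _]; [exists true|exists false].
apply: bigcup_countable => // -[] _; first exact: omega1_countable_seg.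
exact: countable1.
Qed.

Lemma B_omega1_set1 (p : omega1) : B_omega1 [set p].
Proof.
apply: sub_gen_smallest; exists `[p, p] => //.
apply/seteqP; split=> q /=; first by rewrite in_itv /= -eq_le => /eqP ->.
by move=> ->; rewrite in_itv /= lexx.
Qed.

Section Representation.
Variables (d : Order.disp_t) (L : latticeType d).

Lemma pair_congruence_subproof (x y : L) :
  smallest (@congruence d L) [set (x, y)] \in compact_congruences L.
Proof. by apply/mem_set; exists [set (x, y)]. Qed.

Definition pair_congruence (x y : L) : Conc L :=
  Sub (smallest (@congruence d L) [set (x, y)]) (pair_congruence_subproof x y).

Lemma congruence_Conc (c : Conc L) : congruence (val c).
Proof. by have /set_mem[E [_ ->]] := valP c; exact: smallest_congruence. Qed.

Lemma pair_congruence_le x y (c : Conc L) :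
  pair_congruence x y <= c <-> val c (x, y).
Proof.
rewrite -Order.le_val; split=> [/asboolP|cxy].
  by apply; exact: sub_gen_smallest.
apply/asboolP; apply: smallest_sub; first exact: congruence_Conc.
by move=> _ ->.
Qed.

Variable g : Conc L -> S_omega1.
Hypotheses (g_bij : bijective g) (gU : {morph g : x y / x `|` y})
  (g0 : g \bot = \bot).

Lemma Conc_iso_le c c' : (g c <= g c') = (c <= c').
Proof. by rewrite !leEjoin -gU (inj_eq (bij_inj g_bij)). Qed.

Lemma Conc_iso_surj (u : set omega1 *p set omega1) :
  S_omega1_set u -> exists c, val (g c) = u.
Proof.
case: g_bij => h _ hK /mem_set Su.
by exists (h (Sub u Su)); rewrite hK SubK.
Qed.

Lemma Conc_iso_leE c c' : c <= c' <->
  ((val (g c)).1 `<=` (val (g c')).1 /\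
   (val (g c)).2 `<=` (val (g c')).2)%classic.
Proof.
rewrite -Conc_iso_le -Order.le_val.
split=> [/andP[/asboolP ? /asboolP]//|[? ?]].
by apply/andP; split; apply/asboolP.
Qed.

Lemma Conc_isoU c c' : val (g (c `|` c')) = val (g c) `|` val (g c').
Proof. by rewrite gU. Qed.

(* The pairs whose principal congruence does not have [p] in its second
   component form a maximal congruence, since
   [(omega1, omega1 \ {p})] belongs to [S_omega1]. *)
Lemma maximal_Conc (p : omega1) : exists c : Conc L,
  (forall x y, val c (x, y) <-> ~ (val (g (pair_congruence x y))).2 p) /\
  (forall x y, ~ val c (x, y) ->
    smallest (@congruence d L) (val c `|` [set (x, y)])%classic = setT).
Proof.
have [c gc] : exists c, val (g c) = (setT, ~` [set p])%classic.
  apply: Conc_iso_surj; right; split=> /=.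
    by split; [right|move=> /seteqP[/(_ p Logic.I)]].
  have [_ BC _] := boolean_subalgebra_B_omega1.
  split; first by apply: BC; exact: B_omega1_set1.
  have [a pa] := omega1_no_max p; exists a => q /= + qp; apply.
  by rewrite /ord_set /= qp.
have cE x y : val c (x, y) <-> ~ (val (g (pair_congruence x y))).2 p.
  rewrite -pair_congruence_le Conc_iso_leE gc /=.
  split=> [[_ h] /h /(_ erefl) //|np].
  by split=> // q gq qp; apply: np; rewrite -qp.
exists c; split=> // x y ncxy; apply/seteqP; split=> // -[a b] _.
have nn : (val (g (pair_congruence x y))).2 p.
  by apply: contrapT => /cE.
suff /pair_congruence_le : pair_congruence a b <= c `|` pair_congruence x y.
  apply: smallest_sub; first exact: smallest_congruence.
  rewrite subUset; split.
    by apply: sub_smallest => z; left.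
  apply: smallest_sub; first exact: smallest_congruence.
  by apply: sub_smallest => z; right.
(* Adding the missing point [p] yields the top of [S_omega1]. *)
rewrite Conc_iso_leE Conc_isoU gc; split=> /= q _; first by left.
by have [->|qp] := pselect (q = p); [right|left].
Qed.

(** Take the congruence of [({p}, omega1)]. If all its pairs had an empty first component, so would
    the join of its finitely many generators. *)
Lemma ex_pair_congruence (p : omega1) : exists x y : L,
  [/\ x <= y, (val (g (pair_congruence x y))).1 `<=` [set p] &
      (val (g (pair_congruence x y))).1 !=set0]%classic.
Proof.
have [c gc] : exists c, val (g c) = ([set p], setT)%classic.
  apply: Conc_iso_surj; right; split=> /=.
    split; first by left; exact: finite_set1.
    by move=> /seteqP[/(_ p erefl)].
  have [B0 BC _] := boolean_subalgebra_B_omega1; split.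
    by rewrite -setC0; exact: BC.
  by exists p.
have [x [y [cxy ne]]] : exists x y, val c (x, y) /\
    (val (g (pair_congruence x y))).1 !=set0.
  apply: contrapT => H.
  have /set_mem[E [/finite_seqP[s ->] cE]] := valP c.
  have sc a b : (a, b) \in s -> val c (a, b).
    by move=> ab; rewrite cE; apply: sub_gen_smallest.
  have [c' [c'0 c's]] : exists c', (val (g c')).1 = set0 /\
      forall a b, (a, b) \in s -> val c' (a, b).
    elim: s sc {cE} => [|[a b] s IH] sc.
      by exists \bot; rewrite g0.
    have [|c' [c'0 c's]] := IH.
      by move=> a' b' h; apply: sc; rewrite inE h orbT.
    exists (pair_congruence a b `|` c'); rewrite Conc_isoU; split.
      rewrite /= c'0 joinx0; apply/seteqP; split=> // q gq; apply: H.
      by exists a, b; split; [apply: sc; rewrite mem_head|exists q].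
    move=> a' b'; rewrite inE => /predU1P[[-> ->]|/c's/pair_congruence_le h];
      apply/pair_congruence_le; first exact: leUl.
    exact: lexUr h.
  have : c <= c'.
    rewrite -Order.le_val; apply/asboolP; rewrite cE.
    apply: smallest_sub; first exact: congruence_Conc.
    by move=> [a b]; exact: c's.
  by rewrite Conc_iso_leE gc c'0 => -[/(_ p erefl)].
(* The meet and the join are comparable and generate the same congruence as [x] and [y]. *)
exists (x `&` y), (x `|` y).
have [rf sm tr mt jn] := congruence_Conc c.
split; first by rewrite lexUl // leIl.
- have : pair_congruence (x `&` y) (x `|` y) <= c.
    apply/pair_congruence_le.
    have xyx := mt _ _ _ _ (rf x) (sm _ _ cxy).
    have xyy := jn _ _ _ _ (rf x) cxy.
    by rewrite !(meetxx, joinxx) in xyx xyy; exact: tr xyx xyy.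
  by rewrite Conc_iso_leE gc => -[].
- have : pair_congruence x y <= pair_congruence (x `&` y) (x `|` y).
    apply/pair_congruence_le.
    set e := pair_congruence _ _.
    have [rfe sme tre mte jne] := congruence_Conc e.
    have h : val e (x `&` y, x `|` y) by apply/pair_congruence_le.
    have hx := mte _ _ _ _ (rfe x) h.
    have hy := mte _ _ _ _ (rfe y) h.
    move: hx hy; rewrite joinKI meetA meetxx.
    rewrite [y `&` (x `&` y)]meetCA meetxx [x `|` y]joinC joinKI => hx hy.
    exact: tre (sme _ _ hx) hy.
  by rewrite Conc_iso_leE => -[h _]; case: ne => q /h; exists q.
Qed.

(** A nonempty first component forces the second into [F_omega1]. *)
Lemma pair_congruence_cobounded x y :
  ((val (g (pair_congruence x y))).1 !=set0)%classic ->
  exists a, forall q, a <= q -> (val (g (pair_congruence x y))).2 q.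
Proof.
have /set_mem := valP (g (pair_congruence x y)).
case=> [[/= -> _] []//|[_ [_ [a sub]]] _]; exists a => q aq; apply: sub.
by rewrite /ord_set /= leNgt in aq *; exact/negP.
Qed.

Lemma Conc_not_S_omega1 : locally_finite L -> lower_bounded_lattice L -> False.
Proof.
move=> lfL lbL.
have [p _] : exists p : omega1, True.
  apply: contrapT => /forallNP n; apply: omega1_uncountable.
  by rewrite (_ : setT = set0) // -subset0 => x _; case: (n x).
have [r pr] := omega1_no_max p.
have [x [y [xy xyp ne]]] := ex_pair_congruence p.
have [z [w [zw zwr ne']]] := ex_pair_congruence r.
pose a := x `|` (y `&` z); pose b := x `|` (y `&` w).
have abxy : pair_congruence a b <= pair_congruence x y.
  apply/pair_congruence_le; set e := pair_congruence _ _.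
  have [rf sm tr mt jn] := congruence_Conc e.
  have h : val e (y, x) by apply: sm; apply/pair_congruence_le.
  (* Replacing [y] by [x] in the meet with [t] lets [x] absorb it. *)
  have col t : val e (x `|` (y `&` t), x).
    by have := jn _ _ _ _ (rf x) (mt _ _ _ _ h (rf t)); rewrite meetKU.
  exact: tr (col z) (sm _ _ (col w)).
have abzw : pair_congruence a b <= pair_congruence z w.
  apply/pair_congruence_le; set e := pair_congruence _ _.
  have [rf sm tr mt jn] := congruence_Conc e.
  by apply: jn (rf x) _; apply: mt (rf y) _; apply/pair_congruence_le.
have ab0 : (val (g (pair_congruence a b))).1 = set0.
  apply/seteqP; split=> // q abq.
  have /Conc_iso_leE[/(_ q abq)/xyp qp _] := abxy.
  have /Conc_iso_leE[/(_ q abq)/zwr qr _] := abzw.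
  by move: pr; rewrite -qp -qr ltxx.
have [s sub] : exists s,
    ((val (g (pair_congruence a b))).2 `<=` ord_set s)%classic.
  have /set_mem := valP (g (pair_congruence a b)).
  case=> [[_ [_ [s h]]]|[[_ n0] _]]; first by exists s.
  by case: n0.
have [t xyt] := pair_congruence_cobounded ne.
have [t' zwt] := pair_congruence_cobounded ne'.
(* A point in both cobounded second components, beyond the bound for [(a, b)]. *)
pose q := Order.max s (Order.max t t').
have [sq tq t'q] : [/\ s <= q, t <= q & t' <= q].
  by rewrite /q !le_max !lexx !orbT.
suff /sub : (val (g (pair_congruence a b))).2 q.
  by rewrite /ord_set /= ltNge sq.
have [c [cE cmax]] := maximal_Conc q.
have chain := maximal_congruence_chain lfL lbL (congruence_Conc c) cmax.
have [rf sm tr mt jn] := congruence_Conc c.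
have nxy : ~ val c (x, y) by move=> /cE; apply; exact: xyt.
have nzw : ~ val c (z, w) by move=> /cE; apply; exact: zwt.
apply: contrapT => /cE cab.
(* Modulo [c], the interval between [o] and [i] has just two elements. *)
pose o := x `&` z; pose i := y `|` w.
have ox : val c (o, x) by have [//|/nxy] := chain o x y (leIl _ _) xy.
have oz : val c (o, z) by have [//|/nzw] := chain o z w (leIr _ _) zw.
have yi : val c (y, i) by have [/nxy|//] := chain x y i xy (leUl _ _).
have wi : val c (w, i) by have [/nzw|//] := chain z w i zw (leUr _ _).
have oi : o <= i by apply: le_trans (leUl _ _); apply: le_trans xy; exact: leIl.
(* Modulo [c], [a] evaluates to [o] and [b] to [i], so identifying them would collapse [(x, y)]. *)
have oa : val c (o, a).
  have := jn _ _ _ _ ox (mt _ _ _ _ (sm _ _ yi) oz).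
  by rewrite (meet_idPr oi) joinxx.
have bi : val c (b, i).
  have := jn _ _ _ _ (sm _ _ ox) (mt _ _ _ _ yi wi).
  by rewrite meetxx (join_idPr oi).
have ia : val c (a, y) := tr _ _ _ cab (tr _ _ _ bi (sm _ _ yi)).
exact: nxy (tr _ _ _ (sm _ _ ox) (tr _ _ _ oa ia)).
Qed.

End Representation.

Theorem proposition6p5 :
  ~ exists (d : Order.disp_t) (L : latticeType d),
      [/\ locally_finite L, lower_bounded_lattice L
        & join0_isomorphic (Conc L) S_omega1].
Proof.
move=> [d [L [lfL lbL [g [g_bij gU g0]]]]].
exact: (Conc_not_S_omega1 g_bij gU g0).
Qed.
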